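(* Let $S$ be a finite nilpotent semigroup with zero $z$, let $M=S\cup\{I\}$ be the monoid obtained by adjoining an identity $I$ to $S$, and let $\mathbb C_0(M,c)$ be a twisted contracted monoid algebra of $M$. Then the determinant $\widetilde\theta_{M,c}$ vanishes identically unless $M$ has a unique annihilating element $z'$. In this case, define an $(M\setminus\{z\})\times(M\setminus\{z\})$-matrix $A$ by $$A_{s,t}=\begin{cases}c(s,t),&\text{if } st=z'\\0,&\text{else.}\end{cases}$$ Then $\widetilde\theta_{M,c}=\det A\cdot x_{z'}^{|S|}$.
   Context: A semigroup $S$ is nilpotent if it has a zero $z$ and, for some $k\ge 1$, every product of $k$ elements of $S$ equals $z$. A nonzero element $m\in M$ (i.e. $m\neq z$) is annihilating if $mS=\{z\}=Sm$. A twisted contracted monoid algebra $\mathbb C_0(M,c)$ of a monoid $M$ with zero $z$ is an associative $\mathbb C$-algebra with basis $\{\overline m\mid m\in M\setminus\{z\}\}$ in bijection with $M\setminus\{z\}$ and product $\overline s\cdot\overline t=c(s,t)\overline{st}$ if $st\neq z$ and $\overline s\cdot\overline t=0$ if $st=z$, where $c(s,t)\in\mathbb C^\times$ is defined whenever $st\neq z$, and such that $\overline I$ is the identity of the algebra, i.e. $c(I,m)=1=c(m,I)$ for all $m\ne z$. Its paratrophic determinant $\widetilde\theta_{M,c}$ with respect to this basis is the determinant of the $(M\setminus\{z\})\times(M\setminus\{z\})$ matrix over $\mathbb C[x_m\mid m\in M\setminus\{z\}]$ with $(s,t)$-entry $c(s,t)x_{st}$ if $st\neq z$ and $0$ if $st=z$.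 *)

(* Defs.v *)
From HB Require Import structures.
From mathcomp Require Import all_boot all_order all_algebra all_field.
From mathcomp Require Import reals complex mpoly.

Set Implicit Arguments.
Unset Strict Implicit.
Unset Printing Implicit Defensive.

Local Open Scope ring_scope.

(* A finite semigroup is a [finType] with a [SemiGroup.law], a finite monoid is
   a [finType] with a [Monoid.law]: finType and semigroupType have no join in
   the hierarchy, and none can be added below the existing finite groups. *)

Section Semigroup.

Variables (S : Type) (mul : SemiGroup.law S).

Definition is_zero (z : S) : Prop := left_zero z mul /\ right_zero z mul.

(* [foldl mul x s] is a product of [k.+1] elements: the number of factors is
   at least 1. *)
Definition nilpotent_semigroup (z : S) : Prop :=
  is_zero z /\
  exists k : nat, forall (x : S) (s : k.-tuple S), foldl mul x s = z.

End Semigroup.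

(* [Some] embeds [S] and [None] is the new identity, adjoined even when [S]
   already has one. *)
Definition adjoin1_mul (S : Type) (mul : S -> S -> S) (a b : option S) :
    option S :=
  match a, b with
  | None, _ => b
  | _, None => a
  | Some s, Some t => Some (mul s t)
  end.

Section Adjoin1.

Variables (S : Type) (mul : SemiGroup.law S).

Fact adjoin1_mulA : associative (adjoin1_mul mul).
Proof. by move=> [a|] [b|] [c|] //=; rewrite SemiGroup.opA. Qed.

Fact adjoin1_mul1m : left_id None (adjoin1_mul mul).
Proof. by []. Qed.

Fact adjoin1_mulm1 : right_id None (adjoin1_mul mul).
Proof. by case. Qed.

HB.instance Definition _ :=
  Monoid.isLaw.Build (option S) None (adjoin1_mul mul)
    adjoin1_mulA adjoin1_mul1m adjoin1_mulm1.

End Adjoin1.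

Definition annihilating (S : finType) (mul : SemiGroup.law S)
    (z m : option S) : Prop :=
  [/\ m != z,
      [set adjoin1_mul mul m (Some s) | s : S] = [set z]
    & [set adjoin1_mul mul (Some s) m | s : S] = [set z]].

Section Twisted.

Variables (R : realType) (M : finType) (e : M) (mul : Monoid.law e) (z : M).

Definition nonzero : finType := {m : M | m != z}.

(* [c s t] matters only when [mul s t != z]. *)
Variable c : M -> M -> R[i].

Definition is_twisted_contracted_algebra
    (A : falgType R[i]) (b : nonzero -> A) : Prop :=
  [/\ basis_of {:A} (codom b),
      forall s t : M, mul s t != z -> c s t != 0,
      forall s t : nonzero,
        b s * b t =
          if insub (mul (val s) (val t)) is Some u
          then c (val s) (val t) *: b u
          else 0,
      forall u : nonzero, val u = e -> b u = 1
    & forall m : M, m != z -> c e m = 1 /\ c m e = 1].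

(* The elements of [M \ {z}] index rows, columns and variables through the
   enumeration [enum_rank] / [enum_val]. *)
Definition xvar (m : nonzero) : {mpoly R[i][#|nonzero|]} :=
  'X_(enum_rank m).

Definition paratrophic_mx : 'M[{mpoly R[i][#|nonzero|]}]_#|nonzero| :=
  \matrix_(i, j)
    let s := val (enum_val i) in
    let t := val (enum_val j) in
    if insub (mul s t) is Some u then c s t *: xvar u else 0.

Definition paratrophic_det : {mpoly R[i][#|nonzero|]} := \det paratrophic_mx.

Definition fiber_mx (z' : M) : 'M[R[i]]_#|nonzero| :=
  \matrix_(i, j)
    let s := val (enum_val i) in
    let t := val (enum_val j) in
    if mul s t == z' then c s t else 0.

End Twisted.

(* Main.v *)
Require Import Defs.
From mathcomp Require Import all_boot all_order all_algebra all_field.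
From mathcomp Require Import perm reals complex mpoly.

Import GRing.Theory.

Local Open Scope ring_scope.

(** A linear form [l] on the algebra gives the bilinear form [(a, b) |-> l (a b)],
    with Gram matrix [P_l]; the paratrophic matrix is [P_l] for the generic [l],
    and [A] is [P_mu] for the form [mu] dual to [z'].  If [u] solves
    [P_l u = det P_l . mu], then [P_l R_u = det P_l . P_mu], where [R_u] is right
    multiplication by [u].  The algebra is local, so [R_u] is triangular with
    constant diagonal [u_I], and evaluating at [z'], which only [I] does not
    annihilate, gives [u_I l(z') = det P_l . mu(z')].  Taking determinants and
    eliminating [u_I] shows that [det P_l . mu(z')^n = det P_mu . l(z')^n] as soon
    as [det P_l] or [det P_mu] is nonzero, hence always.  A nilpotent semigroup has
    an annihilating element [z'], and a second one gives a zero row of [A]. *)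

(** * Triangular determinants and sums over nonzero elements *)

(** A permutation with a nonzero term never lowers [d] and raises it at each moved index, yet
    permuting preserves the sum of [d]; so only the identity contributes. *)
Lemma det_strictly_graded (K : comNzRingType) (n : nat) (B : 'M[K]_n)
    (d : 'I_n -> nat) :
  (forall i j, i != j -> B i j != 0 -> (d i < d j)%N) ->
  \det B = \prod_i B i i.
Proof.
move=> Bd; rewrite /determinant (bigD1 (1%g : {perm 'I_n})) //=.
rewrite [X in _ + X]big1 => [|s s1].
  by rewrite addr0 odd_perm1 expr0 mul1r; apply: eq_bigr => i _; rewrite perm1.
have [/existsP[i /eqP Bi0]|/existsPn Bn0] := boolP [exists i, B i (s i) == 0].
  by rewrite (bigD1 i) //= Bi0 mul0r mulr0.
have ds i : (d i <= d (s i))%N.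
  by have [<-//|si] := eqVneq i (s i); apply/ltnW/Bd.
have [i si] : exists i, s i != i.
  apply/existsP; apply: contraNT s1 => /existsPn s1.
  apply/eqP/permP => i; rewrite perm1; apply/eqP.
  by have := s1 i; rewrite negbK.
have : (\sum_i d i < \sum_i d (s i))%N.
  rewrite (bigD1 i) //= [ltnRHS](bigD1 i) //= -addSn leq_add ?leq_sum //.
  by apply: Bd => //; rewrite eq_sym.
by rewrite [X in (X < _)%N](reindex_inj (@perm_inj _ s)) ltnn.
Qed.

Lemma sum_nonzero (K : nmodType) (M : finType) (z : M) (F : M -> K) :
  \sum_(i < #|nonzero z|) F (val (enum_val i)) = \sum_(m | m != z) F m.
Proof.
rewrite -(big_enum_val (A := nonzero z) (fun u : nonzero z => F (val u))).
by rewrite -(big_sub [pred m | m != z]).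
Qed.

(** * Gram matrices of linear forms *)

(** Products equal to [z] get no separate case: the forms it is applied to vanish at [z]. *)
Definition gram_mx (K : comNzRingType) (M : finType) (e : M)
    (mul : Monoid.law e) (z : M) (g : M -> M -> K) (l : M -> K) :
    'M[K]_#|nonzero z| :=
  \matrix_(i, j)
    let s := val (enum_val i) in
    let t := val (enum_val j) in
    g s t * l (mul s t).

Section Gram.

Variables (K : idomainType) (M : finType) (e : M) (mul : Monoid.law e) (z : M).
Hypothesis mul0m : left_zero z mul.
Hypothesis mulm0 : right_zero z mul.
Hypothesis e_neq0 : e != z.
Variable d : M -> nat.
Hypothesis d_mul :
  forall s t, t != e -> mul s t != z -> (d (mul s t) < d s)%N.
Variable g : M -> M -> K.
Hypothesis g_cocycle : forall s t r, mul (mul s t) r != z ->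
  g s t * g (mul s t) r = g t r * g s (mul t r).
Hypothesis g_m1 : forall m, m != z -> g m e = 1.
Variable z' : M.
Hypothesis z'_neq0 : z' != z.
Hypothesis z'_mul : forall m, m != e -> mul z' m = z.

Local Notation P l := (gram_mx K M e mul z g l).
Local Notation n := #|nonzero z|.

(** Cramer's rule: [u] is the adjugate applied to the values of [v], so nothing is divided by the
    determinant. *)
Lemma gram_mx_adj_sol (l v : M -> K) :
  exists u : M -> K, forall s, s != z ->
    \sum_(m | m != z) g s m * l (mul s m) * u m = \det (P l) * v s.
Proof.
pose V : 'cV[K]_n := \col_i v (val (enum_val i)).
pose U := \adj (P l) *m V.
pose u m := if insub m is Some t then U (enum_rank t) 0 else 0.
exists u => s s0.
pose i := enum_rank (exist (fun m => m != z) s s0 : nonzero z).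
have := congr1 (fun W : 'cV_n => W i 0) (mulmxA (P l) (\adj (P l)) V).
rewrite mul_mx_adj mul_scalar_mx mxE [in RHS]mxE [V i 0]mxE enum_rankK /= => <-.
rewrite -sum_nonzero; apply: eq_bigr => j _.
by rewrite mxE enum_rankK /= /u valK enum_valK.
Qed.

(** Column [j] holds the coordinates of the [j]-th basis vector times the element with coordinates
    [u]. *)
Definition rmul_mx (u : M -> K) : 'M[K]_n :=
  \matrix_(i, j) \sum_(m | m != z)
    (if mul (val (enum_val j)) m == val (enum_val i)
     then g (val (enum_val j)) m * u m else 0).

(** Right factors other than [e] strictly lower [d], so only [m = e] reaches the diagonal. *)
Lemma det_rmul_mx (u : M -> K) : \det (rmul_mx u) = u e ^+ n.
Proof.
rewrite (det_strictly_graded _ _ _ (fun i => d (val (enum_val i)))) => [|i j ij].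
  rewrite -[in RHS](card_ord n) -prodr_const; apply: eq_bigr => i _.
  rewrite mxE (bigD1 e) //= Monoid.mulm1 eqxx big1 => [|m /andP[_ me]].
    by rewrite addr0 g_m1 ?mul1r //; apply: (valP (enum_val i)).
  case: eqP => // im; have := d_mul (val (enum_val i)) _ me.
  by rewrite im ltnn => /(_ (valP (enum_val i))).
rewrite mxE; apply: contraNT => dij; rewrite big1 // => m _.
case: eqP => // jm; case/negP: dij; rewrite -jm.
apply: d_mul; last by rewrite jm; apply: (valP (enum_val i)).
apply: contra ij => /eqP me; move: jm; rewrite me Monoid.mulm1.
by move/val_inj/enum_val_inj ->.
Qed.

(** The [(a, b)] entry of the product is [l (a (b u)) = l ((a b) u)], and the equation for [u] is
    used at [a b]. *)
Lemma gram_mx_rmul (l v u : M -> K) (l0 : l z = 0) (v0 : v z = 0) :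
    (forall s, s != z ->
      \sum_(m | m != z) g s m * l (mul s m) * u m = \det (P l) * v s) ->
  P l *m rmul_mx u = \det (P l) *: P v.
Proof.
have mulA : associative mul by apply: Monoid.mulmA.
move=> uP; apply/matrixP => i j; rewrite !mxE.
set a := val (enum_val i); set b := val (enum_val j).
transitivity (\sum_(w | w != z) g a w * l (mul a w) *
    \sum_(m | m != z) (if mul b m == w then g b m * u m else 0)).
  by rewrite -sum_nonzero; apply: eq_bigr => k _; rewrite !mxE.
under eq_bigr do rewrite big_distrr.
rewrite exchange_big /=.
transitivity (\sum_(m | m != z) g a b *
    (g (mul a b) m * l (mul (mul a b) m) * u m)).
  apply: eq_bigr => m m0; have [bm0|bm0] := eqVneq (mul b m) z.
    rewrite big1 => [|w w0]; last by rewrite bm0 eq_sym (negPf w0) mulr0.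
    by rewrite -mulA bm0 mulm0 l0 mulr0 mul0r mulr0.
  rewrite (bigD1 (mul b m)) //= eqxx big1 => [|w /andP[_ wbm]]; last first.
    by rewrite eq_sym (negPf wbm) mulr0.
  (* The cocycle identity is known only for nonzero triple products; otherwise [l0] kills both
     sides. *)
  rewrite addr0; have [abm0|abm0] := eqVneq (mul (mul a b) m) z.
    by rewrite mulA abm0 l0 !(mulr0, mul0r).
  rewrite mulA !mulrA g_cocycle //.
  by congr (_ * _); rewrite [g b m * _]mulrC mulrAC.
rewrite -big_distrr /=; have [ab0|ab0] := eqVneq (mul a b) z.
  rewrite ab0 v0 !mulr0 big1 ?mulr0 // => m _.
  by rewrite mul0m l0 mulr0 mul0r.
by rewrite uP // mulrCA.
Qed.

Lemma det_gram_mx_neq0 (l v : M -> K) (l0 : l z = 0) (v0 : v z = 0) :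
    \det (P l) != 0 ->
  \det (P l) * v z' ^+ n = \det (P v) * l z' ^+ n.
Proof.
move=> Pl0; have [u uP] := gram_mx_adj_sol l v.
have uz' : u e * l z' = \det (P l) * v z'.
  rewrite -uP // (bigD1 e) //= big1 => [|m /andP[_ me]].
    by rewrite addr0 g_m1 // mul1r Monoid.mulm1 mulrC.
  by rewrite z'_mul // l0 mulr0 mul0r.
have := congr1 determinant (gram_mx_rmul l v u l0 v0 uP).
rewrite det_mulmx det_rmul_mx detZ => Pu.
(* After this scaling the right side is [\det (P l) * (u e * l z') ^+ n], where [uz'] eliminates
   [u e]. *)
apply: (mulfI (expf_neq0 n Pl0)).
by rewrite [RHS]mulrA -Pu -[RHS]mulrA -exprMn uz' exprMn mulrCA.
Qed.

(** The identity is symmetric in [l] and [v], so one nonzero determinant suffices; if both vanish,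
    so do both sides. *)
Lemma det_gram_mx (l v : M -> K) (l0 : l z = 0) (v0 : v z = 0) :
  \det (P l) * v z' ^+ n = \det (P v) * l z' ^+ n.
Proof.
have [Pl0|] := eqVneq (\det (P l)) 0; last exact: det_gram_mx_neq0.
have [Pv0|] := eqVneq (\det (P v)) 0; first by rewrite Pl0 Pv0 !mul0r.
by move/det_gram_mx_neq0 => ->.
Qed.

Lemma det_gram_mx_delta (l : M -> K) (l0 : l z = 0) :
  \det (P l) = \det (P (fun m => (m == z')%:R)) * l z' ^+ n.
Proof.
rewrite -det_gram_mx ?eqxx ?expr1n ?mulr1 //.
by rewrite eq_sym (negPf z'_neq0).
Qed.

End Gram.

(** * Nilpotency: strict descent and annihilating elements *)

Section Nilpotent.

Variables (S : finType) (mul : SemiGroup.law S) (z : S).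
Hypothesis nilS : nilpotent_semigroup mul z.

Local Notation mulM := (adjoin1_mul mul).

(** Iterating gives [m = m t^k], a product of [k + 1] factors, hence [z]. *)
Lemma nilpotent_mul_fixr (m t : S) : mul m t = m -> m = z.
Proof.
case: nilS => _ [k kz] mt; have := kz m (nseq_tuple k t).
by rewrite /=; elim: k {kz} => //= k; rewrite mt.
Qed.

Lemma nilpotent_mul_fixl (m t : S) : mul t m = m -> m = z.
Proof.
case: nilS => -[mul0m mulm0] [k kz] tm; have := kz t (nseq_tuple k t).
have tkm : mul (foldl mul t (nseq k t)) m = m.
  (* The head of [foldl] changes at each step, so the induction runs over every [x] that fixes [m]
     from the left. *)
  have tjm x : mul x m = m -> mul (foldl mul x (nseq k t)) m = m.
    elim: k {kz} x => //= k IH x xm.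
    by apply: IH; rewrite -SemiGroup.opA tm.
  exact: tjm.
by move=> /= tk; rewrite -tkm tk mul0m.
Qed.

Lemma adjoin1_mul0m : left_zero (Some z) mulM.
Proof. by case: nilS => -[z0 _] _ [s|] //=; rewrite z0. Qed.

Lemma adjoin1_mulm0 : right_zero (Some z) mulM.
Proof. by case: nilS => -[_ z0] _ [s|] //=; rewrite z0. Qed.

Lemma adjoin1_mul_fixr (m : option S) (t : S) :
  mulM m (Some t) = m -> m = Some z.
Proof. by case: m => [m|] //= [/nilpotent_mul_fixr ->]. Qed.

Lemma adjoin1_mul_fixl (m : option S) (t : S) :
  mulM (Some t) m = m -> m = Some z.
Proof. by case: m => [m|] //= [/nilpotent_mul_fixl ->]. Qed.

(** This size of [m S] serves as the grading [d]. *)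
Definition rideal_card (m : option S) : nat :=
  #|[set mulM m (Some s) | s : S]|.

Definition lideal_card (m : option S) : nat :=
  #|[set mulM (Some s) m | s : S]|.

(** [m t S] lies in [m S], and [m t] is in [m S] but not in [m t S]: no nonzero element is fixed by
    a right factor from [S]. *)
Lemma rideal_card_mulr (m : option S) (t : S) :
  mulM m (Some t) != Some z ->
  (rideal_card (mulM m (Some t)) < rideal_card m)%N.
Proof.
move=> mt0; apply: proper_card; apply/properP; split.
  apply/subsetP => _ /imsetP[s _ ->]; apply/imsetP; exists (mul t s) => //.
  by rewrite -(adjoin1_mulA mul).
exists (mulM m (Some t)); first exact: imset_f.
apply: contra mt0 => /imsetP[s _ /esym/adjoin1_mul_fixr ->].
by [].
Qed.

Lemma lideal_card_mull (m : option S) (t : S) :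
  mulM (Some t) m != Some z ->
  (lideal_card (mulM (Some t) m) < lideal_card m)%N.
Proof.
move=> tm0; apply: proper_card; apply/properP; split.
  apply/subsetP => _ /imsetP[s _ ->]; apply/imsetP; exists (mul s t) => //.
  by rewrite (adjoin1_mulA mul).
exists (mulM (Some t) m); first exact: imset_f.
apply: contra tm0 => /imsetP[s _ /esym/adjoin1_mul_fixl ->].
by [].
Qed.

(** Left translation by [t] maps [m S] onto [t m S]. *)
Lemma rideal_card_mull (m : option S) (t : S) :
  (rideal_card (mulM (Some t) m) <= rideal_card m)%N.
Proof.
apply: leq_trans (leq_imset_card (mulM (Some t)) _).
apply/subset_leq_card/subsetP => _ /imsetP[s _ ->].
by rewrite -(adjoin1_mulA mul); do 2!apply: imset_f.
Qed.

Lemma lideal_card_mulr (m : option S) (t : S) :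
  (lideal_card (mulM m (Some t)) <= lideal_card m)%N.
Proof.
apply: leq_trans (leq_imset_card (mulM^~ (Some t)) _).
apply/subset_leq_card/subsetP => _ /imsetP[s _ ->].
by rewrite (adjoin1_mulA mul); apply/imset_f/imset_f.
Qed.

Lemma annihilatingP (m : option S) :
  annihilating mul (Some z) m <->
  [/\ m != Some z, forall s, mulM m (Some s) = Some z
    & forall s, mulM (Some s) m = Some z].
Proof.
split=> -[m0 mS Sm]; split=> //.
- by move=> s; apply/set1P; rewrite -mS; apply: imset_f.
- by move=> s; apply/set1P; rewrite -Sm; apply: imset_f.
- apply/setP => x; rewrite inE; apply/imsetP/eqP => [[s _ ->]//|->].
  by exists z.
- apply/setP => x; rewrite inE; apply/imsetP/eqP => [[s _ ->]//|->].
  by exists z.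
Qed.

(** Minimise the sum of the sizes of [m S] and [S m] over nonzero [m]: a nonzero multiple on either
    side would shrink one term and not enlarge the other. *)
Lemma exists_annihilating : exists m, annihilating mul (Some z) m.
Proof.
have I0 : predC1 (Some z) None by [].
case: (arg_minnP (fun m => rideal_card m + lideal_card m)%N I0) => m /= m0 mmin.
exists m; apply/annihilatingP; split=> // s; apply/eqP; apply: contraT => ms0.
  have := mmin _ ms0; rewrite leqNgt -addSn leq_add //.
    exact: rideal_card_mulr.
  exact: lideal_card_mulr.
have := mmin _ ms0; rewrite leqNgt -addnS leq_add //.
  exact: rideal_card_mull.
exact: lideal_card_mull.
Qed.

(** The adjoined identity makes up for the removed zero, whence the exponent [#|S|]. *)
Lemma card_nonzero_adjoin1 : #|nonzero (Some z)| = #|S|.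
Proof.
rewrite card_sig -[RHS]/(#|S|.+1.-1) -card_option -(cardC1 (Some z)).
by apply: eq_card => m; rewrite !inE.
Qed.

End Nilpotent.

(** * The twisted algebra and its paratrophic determinant *)

(** Compare the coefficients of a nonzero basis vector in the two bracketings of a triple
    product. *)
Lemma twisted_cocycle (R : realType) (M : finType) (e : M) (mul : Monoid.law e)
    (z : M) (mul0m : left_zero z mul) (mulm0 : right_zero z mul)
    (c : M -> M -> R[i]) (A : falgType R[i]) (b : nonzero z -> A) :
    is_twisted_contracted_algebra mul c b ->
  forall s t r, mul (mul s t) r != z ->
  c s t * c (mul s t) r = c t r * c s (mul t r).
Proof.
case=> bB _ bM _ _ s t r str0.
(* Extending [b] by 0 at [z] makes the product rule [BM] hold for all pairs. *)
pose B m := if insub m is Some u then b u else 0.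
have Bz : B z = 0 by rewrite /B insubF ?eqxx.
have BM x y : B x * B y = c x y *: B (mul x y).
  have [->|x0] := eqVneq x z; first by rewrite mul0m Bz mul0r scaler0.
  have [->|y0] := eqVneq y z; first by rewrite mulm0 Bz mulr0 scaler0.
  rewrite /B (insubT (fun m => m != z) x0) (insubT (fun m => m != z) y0) bM.
  by case: insubP => // _; rewrite scaler0.
have B0 : B (mul (mul s t) r) != 0.
  rewrite /B (insubT (fun m => m != z) str0).
  by apply: free_not0 (basis_free bB) _; apply: codom_f.
have eqB : (c s t * c (mul s t) r) *: B (mul (mul s t) r) =
           (c t r * c s (mul t r)) *: B (mul (mul s t) r).
  rewrite -!scalerA -BM scalerAl -BM -mulrA BM -scalerAr BM.
  by congr (_ *: (_ *: B _)); apply: Monoid.mulmA.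
apply/eqP; rewrite -subr_eq0.
by move/eqP: eqB; rewrite -subr_eq0 -scalerBl scaler_eq0 (negPf B0) orbF.
Qed.

(** The Gram identity over the polynomial ring, for the generic form [l]. Any annihilating [z'] is
    allowed, so that it also applies when there are several. *)
Lemma paratrophic_det_annihilating (R : realType) (S : finType)
    (mul : SemiGroup.law S) (z : S) (nilS : nilpotent_semigroup mul z)
    (c : option S -> option S -> R[i])
    (A : falgType R[i]) (b : nonzero (Some z) -> A)
    (twA : is_twisted_contracted_algebra (adjoin1_mul mul) c b)
    (z' : nonzero (Some z)) (annz' : annihilating mul (Some z) (val z')) :
  paratrophic_det (adjoin1_mul mul) (Some z) c =
    (\det (fiber_mx (adjoin1_mul mul) (Some z) c (val z')))%:MP
      * xvar R z' ^+ #|S|.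
Proof.
pose g s t : {mpoly R[i][#|nonzero (Some z)|]} := (c s t)%:MP.
pose l m : {mpoly R[i][#|nonzero (Some z)|]} :=
  if insub m is Some u then xvar R u else 0.
have /annihilatingP[_ z'S _] := annz'.
have mul0m := adjoin1_mul0m _ _ _ nilS; have mulm0 := adjoin1_mulm0 _ _ _ nilS.
have l0 : l (Some z) = 0 by rewrite /l insubF ?eqxx.
have lz' : l (val z') = xvar R z' by rewrite /l valK.
have d_mul s t : t != None -> adjoin1_mul mul s t != Some z ->
    (rideal_card S mul (adjoin1_mul mul s t) < rideal_card S mul s)%N.
  by case: t => // t _; apply: rideal_card_mulr nilS _ _.
have g_cocycle s t r :
    adjoin1_mul mul (adjoin1_mul mul s t) r != Some z ->
    g s t * g (adjoin1_mul mul s t) r = g t r * g s (adjoin1_mul mul t r).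
  move=> str0; rewrite /g -!mpolyCM.
  by rewrite (twisted_cocycle _ _ _ _ _ mul0m mulm0 _ _ _ twA).
have g_m1 m : m != Some z -> g m None = 1.
  by move=> m0; case: twA => _ _ _ _ /(_ m m0)[_ cm1]; rewrite /g cm1.
have z'_mul m : m != None -> adjoin1_mul mul (val z') m = Some z.
  by case: m.
transitivity (\det (gram_mx _ _ _ (adjoin1_mul mul) (Some z) g l)).
  congr (\det _); apply/matrixP => i j; rewrite !mxE /l /g.
  by case: insubP => [u _ _|_]; rewrite -?mul_mpolyC ?mulr0.
apply: etrans (det_gram_mx_delta _ _ _ _ _ mul0m mulm0 isT _ d_mul _ g_cocycle
  g_m1 _ (valP z') z'_mul _ l0) _.
rewrite lz' -(card_nonzero_adjoin1 _ z); congr (_ * _).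
rewrite -det_map_mx; congr (\det _); apply/matrixP => i j; rewrite !mxE /g.
by case: eqP => _; rewrite ?mulr1 ?mulr0 ?mpolyC0.
Qed.

Theorem theorem5p2 (R : realType) (S : finType) (mul : SemiGroup.law S)
    (z : S) (nilS : nilpotent_semigroup mul z)
    (c : option S -> option S -> R[i])
    (A : falgType R[i]) (b : nonzero (Some z) -> A)
    (twA : is_twisted_contracted_algebra (adjoin1_mul mul) c b) :
  (~ (exists! z' : option S, annihilating mul (Some z) z') ->
     paratrophic_det (adjoin1_mul mul) (Some z) c = 0) /\
  (forall z' : nonzero (Some z),
     unique (annihilating mul (Some z)) (val z') ->
     paratrophic_det (adjoin1_mul mul) (Some z) c =
       (\det (fiber_mx (adjoin1_mul mul) (Some z) c (val z')))%:MP
         * xvar R z' ^+ #|S|).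
Proof.
split=> [nuniq|z' [annz' _]]; last first.
  exact: paratrophic_det_annihilating twA _ annz'.
have [m annm] := exists_annihilating _ _ _ nilS.
have /annihilatingP[m0 mS Sm] := annm.
pose z' : nonzero (Some z) := exist _ m m0.
(* Since [m] exists, failure of [exists!] must come from a second element; the boolean form makes
   the search for it decidable. *)
have [m' [m'm /annihilatingP[m'0 m'S _]]] :
    exists m', m' != m /\ annihilating mul (Some z) m'.
  have [/existsP[m' /andP[m'm /and3P[m'0 /forallP m'S /forallP Sm']]]|] := boolP
    [exists m', (m' != m) && [&& m' != Some z,
      [forall s, adjoin1_mul mul m' (Some s) == Some z]
      & [forall s, adjoin1_mul mul (Some s) m' == Some z]]].
    exists m'; split=> //; apply/annihilatingP.
    by split=> // s; apply/eqP.
  move=> /existsPn uniqm; case: nuniq; exists m; split=> // m'.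
  case/annihilatingP=> m'0 m'S Sm'; apply/eqP; have := uniqm m'.
  rewrite eq_sym negb_and negbK => /orP[//|/negP[]]; apply/and3P; split=> //.
    by apply/forallP => s; apply/eqP.
  by apply/forallP => s; apply/eqP.
rewrite (paratrophic_det_annihilating _ _ _ _ nilS _ _ _ twA z' annm).
pose i := enum_rank (exist _ m' m'0 : nonzero (Some z)).
suff -> : \det (fiber_mx (adjoin1_mul mul) (Some z) c (val z')) = 0.
  by rewrite mpolyC0 mul0r.
(* The row of [m'] is zero: [m'] times the identity is [m'], and any other product is [z]; neither
   equals [m]. *)
rewrite (expand_det_row _ i) big1 // => j _; rewrite mxE enum_rankK /=.
case: (val (enum_val j)) => [s|]; last first.
  by rewrite Monoid.mulm1 (negPf m'm) mul0r.
by rewrite m'S eq_sym (negPf m0) mul0r.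
Qed.
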